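(* Let $m\ge1$ and $N\ge1$ be integers and let $F:[0,1]\to K(\mathbb R^n)$ be a continuous set-valued function. Then for every $x\in\left[\frac{m-1}{N},1\right]$, $$\mathrm{haus}\big(S^M_{m,N}(F,x),F(x)\big)\le 2\left(1+2\left\lfloor\frac{m+1}{2}\right\rfloor\right)\omega_{[0,1]}(F,1/N),$$ where $\lfloor t\rfloor$ is the maximal integer not greater than $t$.
   Context: $K(\mathbb R^n)$ is the collection of all nonempty compact subsets of $\mathbb R^n$, $|\cdot|$ is the Euclidean norm, $\mathrm{dist}(a,B)=\inf_{b\in B}|a-b|$, and $\mathrm{haus}(A,B)=\max\{\sup_{a\in A}\mathrm{dist}(a,B),\sup_{b\in B}\mathrm{dist}(b,A)\}$ is the Hausdorff distance; continuity of $F$ is with respect to it. $\Pi_B(a)=\{b\in B:|a-b|=\mathrm{dist}(a,B)\}$. The modulus of continuity is $\omega_{[0,1]}(F,\delta)=\sup\{\mathrm{haus}(F(x),F(y)):|x-y|\le\delta,\ x,y\in[0,1]\}$. $b_m$ is the (standard, normalized) B-spline of order $m$ (degree $m-1$) with integer knots and support $[0,m]$: $b_1$ is the indicator function of $[0,1)$, and $b_m(t)=\frac{t}{m-1}b_{m-1}(t)+\frac{m-t}{m-1}b_{m-1}(t-1)$ for $m\ge2$. A metric chain of a finite sequence of compact sets $\{A_0,\dots,A_N\}$ is a vector $(a_0,\dots,a_N)$ with $a_i\in A_i$ for all $i$, for which there is $j$, $0\le j\le N$, such that $a_{i-1}\in\Pi_{A_{i-1}}(a_i)$ for $1\le i\le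 j$ and $a_{i+1}\in\Pi_{A_{i+1}}(a_i)$ for $j\le i\le N-1$. $CH(A_0,\dots,A_N)$ denotes the set of all metric chains. The metric Schoenberg operator of order $m$ is $$S^M_{m,N}(F,x)=\Big\{\sum_{i=0}^N b_m(Nx-i)f_i:\ (f_0,\dots,f_N)\in CH\big(F(0),F(1/N),\dots,F(1)\big)\Big\}.$$ *)

(* Defs.v *)
From HB Require Import structures.
From mathcomp Require Import all_boot all_order all_algebra.
From mathcomp Require Import all_classical all_reals all_analysis.
Set Implicit Arguments.
Unset Strict Implicit.
Unset Printing Implicit Defensive.
Import Order.TTheory GRing.Theory Num.Theory.
Import numFieldNormedType.Exports.
Local Open Scope classical_set_scope.
Local Open Scope ring_scope.

(* The library norm on 'rV[R]_n is the sup norm; it induces the usual topology,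
   so [compact] below is the usual notion. *)
Definition enorm (R : realType) (n : nat) (v : 'rV[R]_n) : R :=
  Num.sqrt (\sum_(i < n) v ord0 i ^+ 2).

Definition dist (R : realType) (n : nat) (a : 'rV[R]_n) (B : set 'rV[R]_n) : R :=
  inf [set enorm (a - b) | b in B].

(* [sup] on R is 0 on unbounded sets; [haus] is meant for bounded nonempty
   arguments. *)
Definition haus (R : realType) (n : nat) (A B : set 'rV[R]_n) : R :=
  Num.max (sup [set dist a B | a in A]) (sup [set dist b A | b in B]).

Definition metric_proj (R : realType) (n : nat) (B : set 'rV[R]_n)
    (a : 'rV[R]_n) : set 'rV[R]_n :=
  [set b | B b /\ enorm (a - b) = dist a B].

Definition compact_valued01 (R : realType) (n : nat) (F : R -> set 'rV[R]_n) : Prop :=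
  forall x : R, x \in `[0, 1] -> F x !=set0 /\ compact (F x).

Definition haus_continuous01 (R : realType) (n : nat) (F : R -> set 'rV[R]_n) : Prop :=
  forall x : R, x \in `[0, 1] -> forall e : R, 0 < e -> exists2 d : R, 0 < d &
    forall y : R, y \in `[0, 1] -> `|x - y| < d -> haus (F x) (F y) < e.

Definition modulus01 (R : realType) (n : nat) (F : R -> set 'rV[R]_n) (delta : R) : R :=
  sup [set h | exists x y : R, [/\ x \in `[0, 1], y \in `[0, 1],
                 `|x - y| <= delta & h = haus (F x) (F y)]].

(* The value at order 0 is a dummy. At order m = k.+1 >= 2, m - 1 is k. *)
Fixpoint bspline (R : realType) (m : nat) (t : R) : R :=
  match m with
  | 0 => 0
  | 1 => \1_(`[0, 1[%classic) t
  | k.+1 => t / k%:R * bspline k t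
            + (k.+1%:R - t) / k%:R * bspline k (t - 1)
  end.

(* The pairs (i, i') with i' = i.+1 are the pairs of consecutive indices. *)
Definition metric_chain (R : realType) (n N : nat) (A : 'I_N.+1 -> set 'rV[R]_n)
    (a : 'I_N.+1 -> 'rV[R]_n) : Prop :=
  (forall i, A i (a i)) /\
  exists j : 'I_N.+1, forall i i' : 'I_N.+1, i' = i.+1 :> nat ->
    ((i' <= j)%N -> metric_proj (A i) (a i') (a i)) /\
    ((j <= i)%N -> metric_proj (A i') (a i) (a i')).

Definition metric_chains (R : realType) (n N : nat) (A : 'I_N.+1 -> set 'rV[R]_n) :
    set ('I_N.+1 -> 'rV[R]_n) :=
  [set a | metric_chain A a].

Definition metric_schoenberg (R : realType) (n m N : nat) (F : R -> set 'rV[R]_n)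
    (x : R) : set 'rV[R]_n :=
  [set \sum_(i < N.+1) bspline m (N%:R * x - i%:R) *: f i
    | f in metric_chains (fun i : 'I_N.+1 => F (i%:R / N%:R))].

(* Main.v *)
Require Import Defs.
From HB Require Import structures.
From mathcomp Require Import all_boot all_order all_algebra.
From mathcomp Require Import all_classical all_reals all_analysis.
From mathcomp Require Import ring lra zify.
Import Order.TTheory GRing.Theory Num.Theory.
Import numFieldNormedType.Exports.
Local Open Scope classical_set_scope.
Local Open Scope ring_scope.

(** Write [w] for the modulus of continuity of [F] at [1 / N] and [t = N x].
For [m - 1 <= t <= N] the weights [bspline m (t - i)] are nonnegative, sum to 1
([sum_bspline]) and vanish unless [t - m < i <= t], so every element of
[metric_schoenberg m N F x] is a convex combination of the last [m] chain
entries up to index [k], the integer part of [t].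

Consecutive entries of a metric chain are metric projections of one another,
hence at distance at most [w]; so each of these entries is within [(m - 1) w]
of [f k] ([metric_chain_dist]), and so is their convex combination.  Finally
[f k] lies in [F (k / N)] with [|k / N - x| <= 1 / N], which puts [f k] within
[w] of a point of [F x].  Conversely, every point of [F x] is within [w] of a
point of [F (k / N)], and some metric chain passes through that point
([metric_chain_through]).  Both one-sided distances are thus at most [m w]
([haus_metric_schoenberg_le]), and [m <= 2 (1 + 2 floor((m + 1) / 2))].

As [sup] returns 0 on unbounded sets, bounding a particular Hausdorff distance
by [haus] or [modulus01] requires boundedness.  For [modulus01] it comes from
the compactness of [[0, 1]]: the values of [F] lie in one common ball
([haus_continuous01_bounded]). *)

(** * The Euclidean norm *)

Section Euclidean.
Context {R : realType} {n : nat}.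
Implicit Types (u v w : 'rV[R]_n) (A B : set 'rV[R]_n).

Lemma enorm_ge0 v : 0 <= enorm v. Proof. exact: sqrtr_ge0. Qed.

Lemma enorm0 : enorm (0 : 'rV[R]_n) = 0.
Proof.
rewrite /enorm big1 ?sqrtr0// => i _.
by rewrite mxE expr0n.
Qed.

Lemma sqr_enorm v : enorm v ^+ 2 = \sum_(i < n) v ord0 i ^+ 2.
Proof. by rewrite sqr_sqrtr// sumr_ge0// => i _; exact: sqr_ge0. Qed.

Lemma enormZ a v : enorm (a *: v) = `|a| * enorm v.
Proof.
apply/eqP; rewrite -(@eqrXn2 _ 2)// ?enorm_ge0 ?mulr_ge0 ?enorm_ge0//.
rewrite exprMn real_normK ?num_real// !sqr_enorm mulr_sumr; apply/eqP.
by apply: eq_bigr => i _; rewrite mxE exprMn.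
Qed.

Lemma enormB u v : enorm (u - v) = enorm (v - u).
Proof. by rewrite -(opprB v u) -scaleN1r enormZ normrN1 mul1r. Qed.

Lemma enorm_eq0 v : enorm v = 0 -> v = 0.
Proof.
move=> v0; apply/rowP => i; rewrite mxE.
have := sqr_enorm v; rewrite v0 expr0n/= => /esym/eqP.
rewrite psumr_eq0; last by move=> j _; exact: sqr_ge0.
by move=> /allP/(_ i (mem_index_enum _)); rewrite implyTb sqrf_eq0 => /eqP.
Qed.

(** Expansion of [0 <= |t u - s v|^2] with [s = |u|] and [t = |v|], divided by
[2 s t]. *)
Lemma cauchy_schwarz u v :
  \sum_(i < n) u ord0 i * v ord0 i <= enorm u * enorm v.
Proof.
have [/enorm_eq0 ->|u0] := eqVneq (enorm u) 0.
  by rewrite enorm0 mul0r big1// => i _; rewrite mxE mul0r.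
have [/enorm_eq0 ->|v0] := eqVneq (enorm v) 0.
  by rewrite enorm0 mulr0 big1// => i _; rewrite mxE mulr0.
set s := enorm u in u0 *; set t := enorm v in v0 *.
have st0 : 0 < s * t by rewrite mulr_gt0// lt_neqAle eq_sym ?u0 ?v0 enorm_ge0.
have : 0 <= \sum_(i < n) (t * u ord0 i - s * v ord0 i) ^+ 2.
  by rewrite sumr_ge0// => i _; exact: sqr_ge0.
rewrite (eq_bigr (fun i => t ^+ 2 * u ord0 i ^+ 2 + s ^+ 2 * v ord0 i ^+ 2
    - 2 * (s * t) * (u ord0 i * v ord0 i))); last by move=> i _; ring.
rewrite sumrB big_split/= -!mulr_sumr -!sqr_enorm -/s -/t => h.
rewrite -(ler_pM2l st0); lra.
Qed.

Lemma ler_enormD u v : enorm (u + v) <= enorm u + enorm v.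
Proof.
rewrite -(@ler_pXn2r _ 2) ?nnegrE ?addr_ge0 ?enorm_ge0// sqr_enorm.
under eq_bigr => i _ do rewrite mxE sqrrD.
rewrite !big_split/= -!sqr_enorm sqrrD lerD2r lerD2l.
by rewrite mulr2n lerD ?cauchy_schwarz.
Qed.

Lemma ler_enorm_dist w u v : enorm (u - v) <= enorm (u - w) + enorm (w - v).
Proof. by rewrite -[u - v](subrKA w); exact: ler_enormD. Qed.

Lemma ler_enorm_sum (I : finType) (f : I -> 'rV[R]_n) :
  enorm (\sum_i f i) <= \sum_i enorm (f i).
Proof.
elim/big_ind2 : _ => [|u a v b ua vb|//]; first by rewrite enorm0.
exact: le_trans (ler_enormD _ _) (lerD ua vb).
Qed.

(** Closed balls are convex. Only the points of nonzero weight have to be close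
to [c]: for B-spline weights these are the few nodes near the evaluation
point. *)
Lemma enorm_convex_comb (I : finType) (w : I -> R) (f : I -> 'rV[R]_n) c r :
  (forall i, 0 <= w i) -> \sum_i w i = 1 ->
  (forall i, w i != 0 -> enorm (f i - c) <= r) ->
  enorm (\sum_i w i *: f i - c) <= r.
Proof.
move=> w0 w1 fc.
rewrite -[c in _ - c]scale1r -w1 scaler_suml -sumrB.
apply: le_trans (ler_enorm_sum _ _) _.
rewrite -[leRHS]mul1r -w1 mulr_suml; apply: ler_sum => i _.
rewrite -scalerBr enormZ ger0_norm//.
have [->|wi] := eqVneq (w i) 0; first by rewrite !mul0r.
by rewrite ler_wpM2l// fc.
Qed.

Lemma continuous_enormB a : continuous (fun v : 'rV[R]_n => enorm (a - v)).
Proof.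
have coord i : continuous (fun v : 'rV[R]_n => (a - v) ord0 i ^+ 2).
  have -> : (fun v : 'rV[R]_n => (a - v) ord0 i ^+ 2) =
      (fun z : R => (a ord0 i - z) ^+ 2) \o (fun v : 'rV[R]_n => v ord0 i).
    by apply/funext => v; rewrite /= !mxE.
  move=> v; apply: continuous_comp; first exact: coord_continuous.
  apply: (@continuous_comp _ _ _ (fun z => a ord0 i - z) (fun z => z ^+ 2)).
    by apply: cvgB; [exact: cvg_cst|exact: cvg_id].
  exact: exprn_continuous.
move=> v; apply: (@continuous_comp _ _ _
  (fun v : 'rV[R]_n => \sum_(i < n) (a - v) ord0 i ^+ 2) Num.sqrt);
  last exact: sqrt_continuous.
by apply: (continuous_big add_continuous) => i _; exact: coord.
Qed.

Lemma compact_enorm_bounded A a : A !=set0 -> compact A ->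
  exists M, forall v, A v -> enorm (a - v) <= M.
Proof.
move=> A0 cA.
have [c _ cmax] := compact_EVT_max A0 cA
  (continuous_subspaceT (continuous_enormB a)).
by exists (enorm (a - c)) => v Av; apply: cmax; rewrite inE.
Qed.

End Euclidean.

(** * Metric projections and the Hausdorff distance *)

Section Hausdorff.
Context {R : realType} {n : nat}.
Implicit Types (a b : 'rV[R]_n) (A B : set 'rV[R]_n).

Lemma dist_le a b B : B b -> dist a B <= enorm (a - b).
Proof.
move=> Bb; apply: ge_inf; last by exists b.
by exists 0 => _ [c _ <-]; exact: enorm_ge0.
Qed.

Lemma metric_proj_nonempty a B : B !=set0 -> compact B ->
  metric_proj B a !=set0.
Proof.
move=> B0 cB.
have [c /set_mem Bc cmin] := compact_EVT_min B0 cB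
  (continuous_subspaceT (continuous_enormB a)).
exists c; split=> //; apply/eqP; rewrite eq_le dist_le// andbT.
apply: lb_le_inf; first by exists (enorm (a - c)), c.
by move=> _ [b Bb <-]; apply: cmin; rewrite inE.
Qed.

Lemma hausC A B : haus A B = haus B A.
Proof. exact: maxC. Qed.

(** Compactness of [A] bounds the set of distances whose [sup] enters [haus]. *)
Lemma dist_le_haus a A B : A a -> B !=set0 -> compact A ->
  dist a B <= haus A B.
Proof.
move=> Aa [b Bb] cA; rewrite /haus le_max; apply/orP; left.
have [M AM] := compact_enorm_bounded A b (ex_intro _ a Aa) cA.
apply: ub_le_sup; last by exists a.
exists M => _ [c Ac <-]; apply: le_trans (dist_le _ _ _ Bb) _.
by rewrite enormB AM.
Qed.

Lemma metric_proj_haus a b A B : A a -> compact A -> metric_proj B a b ->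
  enorm (a - b) <= haus A B.
Proof.
by move=> Aa cA [Bb ->]; apply: dist_le_haus => //; exists b.
Qed.

Lemma haus_near_point a A B : A a -> compact A -> B !=set0 -> compact B ->
  exists2 b, B b & enorm (a - b) <= haus A B.
Proof.
move=> Aa cA B0 cB; have [b ab] := metric_proj_nonempty a B B0 cB.
by exists b; [case: ab|exact: metric_proj_haus].
Qed.

Lemma haus_le A B r : A !=set0 -> B !=set0 ->
  (forall a, A a -> exists2 b, B b & enorm (a - b) <= r) ->
  (forall b, B b -> exists2 a, A a & enorm (a - b) <= r) ->
  haus A B <= r.
Proof.
move=> [a0 Aa0] [b0 Bb0] AB BA; rewrite /haus ge_max; apply/andP; split.
- apply: ge_sup; first by exists (dist a0 B), a0.
  move=> _ [a Aa <-]; have [b Bb] := AB a Aa.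
  exact/le_trans/dist_le.
- apply: ge_sup; first by exists (dist b0 A), b0.
  move=> _ [b Bb <-]; have [a Aa] := BA b Bb; rewrite enormB.
  exact/le_trans/dist_le.
Qed.

End Hausdorff.

(** * The modulus of continuity *)

Section Modulus.
Context {R : realType} {n : nat} {F : R -> set 'rV[R]_n}.
Hypotheses (hF : compact_valued01 F) (hcont : haus_continuous01 F).

(** Near each [x] the values of [F] stay within Hausdorff distance 1 of the
bounded set [F x]; compactness of [[0, 1]] turns these local bounds into a
global one. *)
Lemma haus_continuous01_bounded : exists M, forall x : R, x \in `[0, 1] ->
  forall v, F x v -> enorm v <= M.
Proof.
have /compact_near_coveringP/near_covering_withinP cover :=
  @segment_compact R 0 1.
(* The bound M tends to infinity: near every x, all large M work. *)
have [|M0 [_ hM]] := cover R +oo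
  (fun M x => forall v, F x v -> enorm v <= M) _.
- move=> x x01; have [Fx0 cFx] := hF x x01.
  have [d d0 hd] := hcont x x01 1 ltr01.
  have [M FM] := compact_enorm_bounded (F x) 0 Fx0 cFx.
  exists (ball x d, [set r | M + 1 <= r]).
    split; first exact: nbhsx_ballx.
    exact: nbhs_pinfty_ge (num_real _).
  move=> [y r] /= [xy Mr] y01 v Fyv; have [Fy0 cFy] := hF y y01.
  have [b Fxb vb] := haus_near_point v (F y) (F x) Fyv cFy Fx0 cFx.
  have {}vb : enorm (v - b) <= 1.
    by rewrite (le_trans vb)// hausC ltW// hd.
  have := ler_enormD (v - b) b; have := FM b Fxb.
  rewrite subrK [enorm (0 - b)]enormB subr0.
  by move: Mr vb; lra.
- exists (M0 + 1) => x x01 v Fxv.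
  have M1 : M0 < M0 + 1 by rewrite ltrDl.
  exact: hM _ M1 x x01 v Fxv.
Qed.

Lemma haus_le_modulus01 (delta x y : R) : x \in `[0, 1] -> y \in `[0, 1] ->
  `|x - y| <= delta -> haus (F x) (F y) <= modulus01 F delta.
Proof.
move=> x01 y01 xy; apply: ub_le_sup; last by exists x, y.
have [M FM] := haus_continuous01_bounded.
exists (M + M) => _ [z [t [z01 t01 _ ->]]].
have [[a Fa] _] := hF z z01; have [[b Fb] _] := hF t t01.
have bound u v : F z u -> F t v -> enorm (u - v) <= M + M.
  move=> Fu Fv; apply: le_trans (ler_enorm_dist 0 _ _) _.
  rewrite subr0 [enorm (0 - v)]enormB subr0.
  exact: lerD (FM z z01 u Fu) (FM t t01 v Fv).
apply: haus_le; [by exists a|by exists b| |].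
- by move=> u Fu; exists b => //; exact: bound.
- by move=> v Fv; exists a => //; exact: bound.
Qed.

Lemma modulus01_ge0 (delta : R) : 0 <= delta -> 0 <= modulus01 F delta.
Proof.
move=> delta0; have zero01 : 0 \in `[0, 1 : R] by rewrite in_itv/= lexx ler01.
have [[a Fa] cF0] := hF 0 zero01.
have [b _ ab] := haus_near_point a _ _ Fa cF0 (ex_intro _ a Fa) cF0.
apply: le_trans (enorm_ge0 _) (le_trans ab _).
by apply: haus_le_modulus01 => //; rewrite subrr normr0.
Qed.

End Modulus.

(** * B-splines *)

Section BSpline.
Context {R : realType}.
Implicit Types (t : R) (m N : nat).

Lemma bsplineSS m t : bspline m.+2 t = t / m.+1%:R * bspline m.+1 t +
  (m.+2%:R - t) / m.+1%:R * bspline m.+1 (t - 1).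
Proof. by []. Qed.

Lemma bspline_support m t : bspline m t != 0 -> 0 <= t < m%:R.
Proof.
apply: contraNT; elim: m t => [//|[|m] IH] t ht.
  by rewrite /= indicE memNset//= in_itv/= => /andP[t0 t1]; rewrite t0 t1 in ht.
have /IH/eqP t0 : ~~ (0 <= t < m.+1%:R).
  by apply: contraNN ht => /andP[? ?]; rewrite -[m.+2%:R]natr1; lra.
have /IH/eqP t1 : ~~ (0 <= t - 1 < m.+1%:R).
  by apply: contraNN ht => /andP[? ?]; rewrite -[m.+2%:R]natr1; lra.
by rewrite bsplineSS t0 t1 !mulr0 addr0.
Qed.

Lemma bspline_ge0 m t : 0 <= bspline m t.
Proof.
elim: m t => [//|[|m] IH] t; first by rewrite /= indicE ler0n.
rewrite bsplineSS addr_ge0//.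
- have [->|/bspline_support/andP[t0 _]] := eqVneq (bspline m.+1 t) 0.
    by rewrite mulr0.
  by rewrite mulr_ge0// divr_ge0.
- have [->|/bspline_support/andP[_ t1]] := eqVneq (bspline m.+1 (t - 1)) 0.
    by rewrite mulr0.
  by rewrite mulr_ge0// divr_ge0// subr_ge0 -natr1; lra.
Qed.

(** Partition of unity. In the recursion for order [m + 2], the coefficients
with which [bspline m.+1 (t - i)] enters through the indices [i] and [i - 1]
add up to 1, so the sum reduces to the one for order [m + 1]. The boundary
terms vanish: [t >= m + 1] is past the support of [bspline m.+1], and
[t - (N + 1)] is before it. *)
Lemma sum_bspline m N t : m%:R <= t <= N%:R ->
  \sum_(i < N.+1) bspline m.+1 (t - i%:R) = 1.
Proof.
elim: m => [|m IH] /andP[mt tN].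
  have /andP[kt tk] := truncn_itv mt.
  have kN : (Num.trunc t < N.+1)%N.
    by rewrite ltnS -(@ler_nat R) (le_trans kt).
  rewrite (bigD1 (Ordinal kN))//= indicE mem_set ?big1 ?addr0//.
    move=> i ik; apply/eqP; apply: contraNT ik.
    move=> /(@bspline_support 1)/andP[i0 i1].
    apply/eqP/val_inj => /=; apply/esym/truncn_def.
    by rewrite -natr1; lra.
  by rewrite /= in_itv/=; rewrite -natr1 in tk; lra.
(* G i.+1 is the second summand of the recursion at index i. *)
pose G (j : nat) : R :=
  (m.+1%:R - t + j%:R) / m.+1%:R * bspline m.+1 (t - j%:R).
have G0 : G 0%N = 0.
  rewrite /G subr0; have [->|/bspline_support/andP[_]] :=
    eqVneq (bspline m.+1 t) 0; first by rewrite mulr0.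
  by rewrite ltNge mt.
have GN : G N.+1 = 0.
  rewrite /G; have [->|/bspline_support/andP[]] :=
    eqVneq (bspline m.+1 (t - N.+1%:R)) 0; first by rewrite mulr0.
  by rewrite -natr1; lra.
have shift : \sum_(i < N.+1) G i.+1 = \sum_(i < N.+1) G i.
  transitivity (\sum_(i < N.+2) G i).
    by rewrite [RHS]big_ord_recl G0 add0r.
  by rewrite big_ord_recr/= GN addr0.
rewrite -[RHS]IH; last by rewrite tN andbT -[m.+1%:R]natr1 in mt *; lra.
rewrite (eq_bigr (fun i : 'I_N.+1 =>
    (t - i%:R) / m.+1%:R * bspline m.+1 (t - i%:R) + G i.+1)); last first.
  move=> i _; rewrite bsplineSS /G; congr (_ + _ / _ * bspline _ _).
    by rewrite -[m.+2%:R]natr1 -[i.+1%:R]natr1; ring.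
  by rewrite -[i.+1%:R]natr1; ring.
rewrite big_split/= shift -big_split/=; apply: eq_bigr => i _.
rewrite /G -mulrDl -mulrDl.
rewrite (_ : t - i%:R + (m.+1%:R - t + i%:R) = m.+1%:R); last by ring.
by rewrite divff ?mul1r// pnatr_eq0.
Qed.

End BSpline.

(** * Metric chains *)

Section Chains.
Context {R : realType} {n N : nat} {A : 'I_N.+1 -> set 'rV[R]_n}.
Hypotheses (A0 : forall i, A i !=set0) (cA : forall i, compact (A i)).

(** Whichever of two consecutive entries is the projection of the other, their
distance is at most the Hausdorff distance of the two sets. *)
Lemma metric_chain_dist a w (i k : 'I_N.+1) :
  (forall i i' : 'I_N.+1, i' = i.+1 :> nat -> haus (A i) (A i') <= w) ->
  metric_chain A a -> (i <= k)%N -> enorm (a i - a k) <= (k - i)%:R * w.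
Proof.
move=> Aw [Aa [j aj]] ik.
have step (l l' : 'I_N.+1) : l' = l.+1 :> nat -> enorm (a l - a l') <= w.
  move=> ll'; apply: le_trans (Aw l l' ll'); have [toj fromj] := aj l l' ll'.
  have [l'j|jl'] := leqP l' j.
    by rewrite enormB hausC; apply: metric_proj_haus => //; exact: toj.
  by apply: metric_proj_haus => //; apply: fromj; rewrite -ltnS -ll'.
have [d dE] : exists d, d = (k - i)%N by exists (k - i)%N.
rewrite -dE; elim: d k ik dE => [|d IH] k ik dE.
  have -> : k = i by apply/val_inj => /=; lia.
  by rewrite subrr enorm0 mul0r.
have ltk : (k.-1 < N.+1)%N by have := ltn_ord k; lia.
pose l := Ordinal ltk.
have lk : k = l.+1 :> nat by rewrite /=; lia.
apply: le_trans (ler_enorm_dist (a l) _ _) _.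
rewrite -natr1 mulrDl mul1r lerD ?step// IH//=; lia.
Qed.

(** Starting from [z] at the pivot index [k], project successively towards both
ends. *)
Lemma metric_chain_through (k : 'I_N.+1) z : A k z ->
  exists2 a, metric_chain A a & a k = z.
Proof.
move=> Akz.
have /choice[p pP] (q : 'I_N.+1 * 'rV[R]_n) :
  exists b, metric_proj (A q.1) q.2 b by exact: metric_proj_nonempty.
(* g climbs from k towards N, and h descends from k towards 0. *)
pose g d := iteri d (fun e v => p (inord (k + e.+1), v)) z.
pose h d := iteri d (fun e v => p (inord (k - e.+1), v)) z.
pose a (i : 'I_N.+1) := if (k <= i)%N then g (i - k)%N else h (k - i)%N.
have ah (i : 'I_N.+1) : (i <= k)%N -> a i = h (k - i)%N.
  by rewrite /a; case: ltngtP => // -> _; rewrite subnn.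
have fwd (i i' : 'I_N.+1) : (k <= i)%N -> i' = i.+1 :> nat ->
    metric_proj (A i') (a i) (a i').
  move=> ki ii'; rewrite /a ki ii' leqW// subSn// /g [iteri _.+1 _ _]/= -/(g _).
  have -> : inord (k + (i - k).+1) = i'.
    by apply/val_inj; rewrite /= inordK; have := ltn_ord i'; lia.
  exact: pP (i', g (i - k)%N).
have bwd (i i' : 'I_N.+1) : (i' <= k)%N -> i' = i.+1 :> nat ->
    metric_proj (A i) (a i') (a i).
  move=> i'k ii'; rewrite !ah//; last by lia.
  have -> : (k - i = (k - i').+1)%N by lia.
  rewrite /h [iteri _.+1 _ _]/= -/(h _).
  have -> : inord (k - (k - i').+1) = i.
    by apply/val_inj; rewrite /= inordK; have := ltn_ord i; lia.
  exact: pP (i, h (k - i')%N).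
have ak : a k = z by rewrite ah// subnn.
exists a => //; split; last first.
  by exists k => i i' ii'; split => [i'k|ki]; [exact: bwd|exact: fwd].
move=> i; case: (ltngtP i k) => [ik|ki|/val_inj ->]; last by rewrite ak.
- have lti : (i.+1 < N.+1)%N by have := ltn_ord k; lia.
  by have [] := bwd i (Ordinal lti) ik erefl.
- have lti : (i.-1 < N.+1)%N by have := ltn_ord i; lia.
  have klti : (k <= Ordinal lti)%N by rewrite /=; lia.
  have ii : i = (Ordinal lti).+1 :> nat by rewrite /=; lia.
  by have [] := fwd _ _ klti ii.
Qed.

End Chains.

(** * Approximation by the metric Schoenberg operator *)

Section Schoenberg.
Context {R : realType} {n : nat} {F : R -> set 'rV[R]_n}.
Hypotheses (hF : compact_valued01 F) (hcont : haus_continuous01 F).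

(** Of the [m + 1] copies of the modulus, [m] come from walking along the chain
across the support of the B-spline, and one from passing between [x] and the
node [k / N] next to it. *)
Lemma haus_metric_schoenberg_le m N x : (0 < N)%N ->
  m%:R <= N%:R * x <= N%:R ->
  haus (metric_schoenberg m.+1 N F x) (F x) <= m.+1%:R * modulus01 F (1 / N%:R).
Proof.
move=> N0 /andP[mt tN]; set w := modulus01 F _.
have N0' : 0 < N%:R :> R by rewrite ltr0n.
have t0 : 0 <= N%:R * x by rewrite (le_trans _ mt).
have x01 : x \in `[0, 1].
  by rewrite in_itv/= -(pmulr_rge0 _ N0') t0 -(ler_pM2l N0') mulr1.
have node01 (i : 'I_N.+1) : i%:R / N%:R \in `[0, 1 : R].
  by rewrite in_itv/= divr_ge0//= ler_pdivrMr// mul1r ler_nat -ltnS.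
have A0 (i : 'I_N.+1) : F (i%:R / N%:R) !=set0 by have [] := hF _ (node01 i).
have cA (i : 'I_N.+1) : compact (F (i%:R / N%:R)) by have [] := hF _ (node01 i).
have [Fx0 cFx] := hF x x01.
have Aw (i i' : 'I_N.+1) : i' = i.+1 :> nat ->
    haus (F (i%:R / N%:R)) (F (i'%:R / N%:R)) <= w.
  move=> ii'; apply: haus_le_modulus01 => //; rewrite ii' -mulrBl.
  rewrite normrM [`|_^-1|]gtr0_norm ?invr_gt0// ler_pM2r ?invr_gt0//.
  by rewrite -natr1 opprD addNKr normrN1.
have /andP[kt tk] := truncn_itv t0.
have ltk : (Num.trunc (N%:R * x) < N.+1)%N.
  by rewrite ltnS -(@ler_nat R) (le_trans kt).
pose k := Ordinal ltk.
have Fkx : haus (F (k%:R / N%:R)) (F x) <= w.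
  apply: haus_le_modulus01 => //.
  rewrite -(ler_pM2l N0') -{1}[N%:R]gtr0_norm// -normrM mulrBr.
  rewrite mul1r divff ?gt_eqF// mulrCA divff ?gt_eqF// mulr1.
  by rewrite ler_norml /=; rewrite -natr1 in tk; lra.
have w0 : 0 <= w by apply: modulus01_ge0 => //; rewrite divr_ge0.
have near_k f : metric_chain (fun i : 'I_N.+1 => F (i%:R / N%:R)) f ->
    enorm (\sum_(i < N.+1) bspline m.+1 (N%:R * x - i%:R) *: f i - f k)
      <= m%:R * w.
  move=> chf; apply: enorm_convex_comb => [i||i /bspline_support/andP[it ti]].
  - exact: bspline_ge0.
  - by apply: sum_bspline; rewrite mt.
  have ik : (i <= k)%N.
    by rewrite -ltnS -(@ltr_nat R) (le_lt_trans _ tk)// -subr_ge0.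
  apply: le_trans (metric_chain_dist cA f w i k Aw chf ik) _.
  rewrite ler_wpM2r// ler_nat leq_subLR -ltnS -addnS -(@ltr_nat R).
  by rewrite (le_lt_trans kt)// natrD addrC -ltrBlDr.
apply: haus_le => //.
- have [z Fz] := A0 k; have [f chf _] := metric_chain_through A0 cA k z Fz.
  by exists (\sum_(i < N.+1) bspline m.+1 (N%:R * x - i%:R) *: f i), f.
- move=> _ [f chf <-]; have [Af _] := chf.
  have [y Fy fky] := haus_near_point _ _ _ (Af k) (cA k) Fx0 cFx.
  exists y => //; apply: le_trans (ler_enorm_dist (f k) _ _) _.
  by rewrite -natr1 mulrDl mul1r lerD ?near_k// (le_trans fky).
- move=> y Fy.
  have [z Fz yz] := haus_near_point _ _ _ Fy cFx (A0 k) (cA k).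
  have [f chf fk] := metric_chain_through A0 cA k z Fz.
  exists (\sum_(i < N.+1) bspline m.+1 (N%:R * x - i%:R) *: f i).
    by exists f.
  apply: le_trans (ler_enorm_dist (f k) _ _) _.
  rewrite -natr1 mulrDl mul1r lerD ?near_k// fk enormB (le_trans yz)//.
  by rewrite hausC.
Qed.

End Schoenberg.

Theorem corollary6p5 (R : realType) (n m N : nat) (hm : (1 <= m)%N) (hN : (1 <= N)%N)
    (F : R -> set 'rV[R]_n) (hF : compact_valued01 F) (hcont : haus_continuous01 F)
    (x : R) (hx : (m%:R - 1) / N%:R <= x <= 1) :
  haus (metric_schoenberg m N F x) (F x)
    <= 2 * (1 + 2 * ((m + 1) %/ 2)%:R) * modulus01 F (1 / N%:R).
Proof.
case: m hm hx => // m _ /andP[mx x1].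
have N0 : 0 < N%:R :> R by rewrite ltr0n.
have mt : m%:R <= N%:R * x <= N%:R.
  rewrite ler_piMr ?(ltW N0)// andbT mulrC.
  by move: mx; rewrite ler_pdivrMr// -natr1 addrK.
apply: le_trans (haus_metric_schoenberg_le hF hcont m N x hN mt) _.
rewrite ler_wpM2r//; first by apply: modulus01_ge0 => //; rewrite divr_ge0.
rewrite -natrM -(natrD _ 1%N) -natrM ler_nat; lia.
Qed.
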